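(* Every atomic co-well-ordered positive monoid $M$ is a length-finite factorization monoid; that is, if $M$ is an atomic co-well-ordered positive monoid, then for every $b \in M$ and every $\ell \in \mathbb{N}$ the element $b$ has only finitely many factorizations of length $\ell$ in $M$.
   Context: $\mathbb{N}$ denotes the set of positive integers. A positive monoid is an additive submonoid of $\mathbb{R}_{\ge 0}$ (a subset of the nonnegative reals containing $0$ and closed under addition). Its only invertible element is $0$. A sequence of real numbers (indexed by $\mathbb{N}$) is co-well-ordered if it contains no strictly increasing (infinite) subsequence. A positive monoid $M$ is co-well-ordered if it can be generated, as an additive monoid, by the set of terms of a co-well-ordered sequence. An atom of a positive monoid $M$ is an element $a \in M \setminus \{0\}$ such that whenever $a = b + c$ with $b, c \in M$, then $b = 0$ or $c = 0$; $\mathcal{A}(M)$ is the set of atoms. $M$ is atomic if every nonzero element of $M$ is a sum of finitely many atoms (repetitions allowed). $\mathsf{Z}(M)$ is the free commutative monoid on $\mathcal{A}(M)$ (formal sums of atoms, i.e., finite multisets of atoms), and $\pi : \mathsf{Z}(M) \to M$ is the monoid homomorphism with $\pi(a) = a$ for every atom $a$. The factorizations of $b \in M$ are the elements of $\mathsf{Z}(b) = \{z \in \mathsf{Z}(M) \mid \pi(z) = b\}$. The length $|z|$ of a factorization $z$ is its number of atoms counted with repetitions, and $\mathsf{Z}_\ell(b) = \{z \in \mathsf{Z}(b) \mid |z| = \ell\}$. $M$ is a length-finite factorization monoid (LFFM) if $M$ is atomic and $|\mathsf{Z}_\ell(b)| < \infty$ for all $b \in M$ and $\ell \in \mathbb{N}$.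 *)

(* Defs.v *)
From mathcomp Require Import all_boot all_order all_algebra.
From mathcomp Require Import finmap multiset.
From mathcomp Require Import boolp classical_sets functions cardinality reals.
From mathcomp Require Import sequences.

Set Implicit Arguments.
Unset Strict Implicit.
Unset Printing Implicit Defensive.

Import Order.TTheory GRing.Theory Num.Theory.

Local Open Scope classical_set_scope.
Local Open Scope ring_scope.
Local Open Scope mset_scope.

Section PositiveMonoids.
Variable R : realType.
Implicit Types (M S G : set R) (u : nat -> R) (z : {mset R}).

Definition additive_submonoid S : Prop := GRing.nmod_closed (mem S).

Definition positive_monoid M : Prop :=
  (forall x, M x -> 0 <= x) /\ additive_submonoid M.

Definition generated_submonoid G : set R := smallest additive_submonoid G.

Definition co_well_ordered_seq u : Prop :=
  ~ exists f : nat -> nat, increasing_seq f /\ increasing_seq (u \o f).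

Definition co_well_ordered M : Prop :=
  exists u, co_well_ordered_seq u /\ M = generated_submonoid (range u).

Definition atoms M : set R :=
  [set a | [/\ M a, a <> 0 &
    forall b c, M b -> M c -> a = b + c -> b = 0 \/ c = 0]].

Definition atomic M : Prop :=
  forall x, M x -> x <> 0 ->
    exists s : seq R, (forall a, a \in s -> atoms M a) /\ x = \sum_(a <- s) a.

(* The free commutative monoid on the atoms, as the multisets of reals
   supported on the atoms; below, sums and sizes of multisets count
   multiplicities. *)
Definition formal_sums M : set {mset R} :=
  [set z | forall a, a \in z -> atoms M a].

Definition factorization_hom z : R := \sum_(a <- z) a.

Definition factorizations M (b : R) : set {mset R} :=
  [set z | formal_sums M z /\ factorization_hom z = b].

Definition factorizations_of_length M (b : R) (l : nat) : set {mset R} :=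
  [set z | factorizations M b z /\ size z = l].

Definition length_finite_factorization_monoid M : Prop :=
  atomic M /\
  forall (b : R) (l : nat), M b -> (0 < l)%N ->
    finite_set (factorizations_of_length M b l).

End PositiveMonoids.

(* Main.v *)
Require Import Defs.
From mathcomp Require Import all_boot all_order all_algebra.
From mathcomp Require Import boolp classical_sets reals.
From mathcomp Require Import finmap multiset functions cardinality sequences.

(** Two distinct factorizations of the same element and of the same length
    cannot be comparable entry by entry: if each entry of one is at most the
    corresponding entry of the other, then equality of the two sums forces
    equality of all entries.  So it is enough to find two comparable members in
    every infinite family of factorizations of a given length.

    This is Dickson's lemma in disguise.  An atom belongs to every generating
    set ([atoms_sub_generators]), so all atoms are terms of a co-well-ordered
    sequence [u].  The set of terms of [u] is well-ordered by [>=]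
    ([co_well_ordered_has_max]), and therefore every sequence of terms of [u],
    whatever the order in which it visits them, has a nonincreasing subsequence
    ([nonincreasing_subseq]).  Refining once per position, a sequence of
    factorizations of length [l], listed as sequences of [l] atoms, has a
    subsequence along which all [l] entries are nonincreasing
    ([simultaneous_nonincreasing_subseq]); any two of its members are
    comparable. *)

Set Implicit Arguments.
Unset Strict Implicit.
Unset Printing Implicit Defensive.

Import Order.TTheory GRing.Theory Num.Theory.

Local Open Scope classical_set_scope.
Local Open Scope ring_scope.

Section Subsequences.
Variable R : realType.
Implicit Types (u x : nat -> R) (f : nat -> nat) (S : set R).

(** A set of terms without maximum keeps growing arbitrarily far along the
    sequence, since the finitely many terms before any given index cannot bound
    it; following it produces the forbidden increasing subsequence. *)
Lemma co_well_ordered_has_max u S :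
  co_well_ordered_seq u -> S `<=` range u -> S !=set0 ->
  exists2 m, S m & forall y, S y -> y <= m.
Proof.
move=> cwo_u subS [v0 Sv0]; apply: contrapT => no_max.
have above v : S v -> exists2 y, S y & v < y.
  move=> Sv; apply: contrapT => no_above; apply: no_max; exists v => // y Sy.
  by rewrite leNgt; apply/negP => lt_vy; apply: no_above; exists y.
have late n v : S v -> exists k, [/\ (n <= k)%N, S (u k) & v < u k].
  elim: n v => [|n IHn] v Sv.
    have [y Sy lt_vy] := above v Sv; have [k _ eq_y] := subS y Sy.
    by exists k; rewrite eq_y.
  have [k [le_nk Sk lt_vk]] := IHn v Sv.
  have [eq_nk|ne_nk] := eqVneq n k; last first.
    by exists k; split=> //; rewrite ltn_neqAle ne_nk.
  (* the term of index n itself served as upper bound: climb once more *)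
  have [k' [le_nk' Sk' lt_kk']] := IHn (u k) Sk.
  exists k'; split=> //; last exact: lt_trans lt_vk lt_kk'.
  rewrite ltn_neqAle le_nk' andbT eq_nk.
  by apply: contraTneq lt_kk' => <-; rewrite ltxx.
have next_ex k : exists k', S (u k) -> [/\ (k < k')%N, S (u k') & u k < u k'].
  have [Sk|] := pselect (S (u k)); last by exists 0%N.
  by have [k' ?] := late k.+1 _ Sk; exists k'.
have [next nextP] := choice next_ex.
have [k0 [_ Sk0 _]] := late 0%N v0 Sv0.
have S_iter n : S (u (iter n next k0)).
  by elim: n => //= n IHn; have [] := nextP _ IHn.
apply: cwo_u; exists (fun n => iter n next k0).
by split; apply/increasing_seqP => n /=; have [] := nextP _ (S_iter n).
Qed.

(** Each tail of [x] attains its maximum; jumping repeatedly to a position where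
    the next tail is maximal gives the subsequence. *)
Lemma nonincreasing_subseq u x :
  co_well_ordered_seq u -> (forall n, range u (x n)) ->
  exists2 f, increasing_seq f & nonincreasing_seq (x \o f).
Proof.
move=> cwo_u x_u.
have tail_max n :
    exists m, (n < m)%N /\ forall p, (n < p)%N -> x p <= x m.
  have [||_ [m lt_nm <-] max_m] :=
      @co_well_ordered_has_max u (x @` [set p | (n < p)%N]) cwo_u.
  - by move=> _ [p _ <-].
  - by exists (x n.+1); exists n.+1 => /=.
  by exists m; split=> // p lt_np; apply: max_m; exists p.
have [g gP] := choice tail_max.
exists (fun k => iter k.+1 g 0%N).
  by apply/increasing_seqP => k /=; have [] := gP (g (iter k g 0%N)).
apply/nonincreasing_seqP => k /=; set p := iter k g 0%N.
have [lt_p max_p] := gP p; have [lt_gp _] := gP (g p).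
by apply: max_p; apply: ltn_trans lt_gp.
Qed.

Lemma simultaneous_nonincreasing_subseq u (x : nat -> nat -> R) l :
  co_well_ordered_seq u ->
  (forall i, (i < l)%N -> forall n, range u (x i n)) ->
  exists2 f, increasing_seq f &
    forall i, (i < l)%N -> nonincreasing_seq (x i \o f).
Proof.
move=> cwo_u; elim: l => [|l IHl] x_u; first by exists id.
have [i lt_il|f incr_f ni_f] := IHl; first exact/x_u/ltnW.
have [n|g incr_g ni_g] := @nonincreasing_subseq u (x l \o f) cwo_u.
  exact: x_u.
exists (f \o g) => [m n|i]; first by rewrite /= incr_f -leEnat incr_g.
rewrite ltnS leq_eqVlt => /predU1P[-> //|lt_il] m n le_mn /=.
by apply: (ni_f i lt_il); rewrite -leEnat incr_g.
Qed.

End Subsequences.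

Lemma eq_sum_le_eq (R : realType) (s t : seq R) :
  size s = size t -> (forall i, (i < size s)%N -> s`_i <= t`_i) ->
  \sum_(a <- s) a = \sum_(a <- t) a -> s = t.
Proof.
move=> eq_size le_st eq_sum; apply: (@eq_from_nth _ 0) => // i lt_i.
have /(_ (Ordinal lt_i)) /(_ isT) : forall j : 'I_(size s), true ->
    t`_j - s`_j = 0.
  apply: psumr_eq0P => [j _|]; first by rewrite subr_ge0 le_st.
  rewrite sumrB -(big_mkord xpredT (nth 0 t)) -(big_mkord xpredT (nth 0 s)).
  by rewrite {1}eq_size -!(big_nth 0 xpredT id) eq_sum subrr.
by move/subr0_eq.
Qed.

(** Removing an atom [a] from the monoid leaves a submonoid, because [a] is not
    a sum of two other elements; so a generating set cannot miss [a]. *)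
Lemma atoms_sub_generators (R : realType) (G : set R) :
  atoms (generated_submonoid G) `<=` G.
Proof.
move=> a [Ma a_neq0 atom_a]; apply: contrapT => Ga'.
suff: (generated_submonoid G `\ a) a by case=> _; apply.
apply: (Ma (generated_submonoid G `\ a)); split; last first.
  move=> x Gx; split; first by move=> N [_]; apply.
  by move=> /= eq_xa; apply: Ga'; rewrite -eq_xa.
have M0 : generated_submonoid G 0 by move=> N [[/set_mem]].
have MD x y : generated_submonoid G x -> generated_submonoid G y ->
    generated_submonoid G (x + y).
  move=> Mx My N NP; have [[_ ND] _] := NP.
  by apply/set_mem/ND; apply/mem_set; [apply: Mx | apply: My].
split=> [|x y]; first by apply/mem_set; split=> //= /esym.
move=> /set_mem[Mx x_neqa] /set_mem[My y_neqa]; apply/mem_set.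
split; first exact: MD.
move=> /= /esym eq_a; have [x0|y0] := atom_a x y Mx My eq_a.
- by apply: y_neqa; rewrite /= eq_a x0 add0r.
- by apply: x_neqa; rewrite /= eq_a y0 addr0.
Qed.

Lemma infinite_set_sequence T (A : set T) :
  infinite_set A -> exists2 z : nat -> T, (forall n, A (z n)) & injective z.
Proof.
move=> /infiniteP/card_leP/unsquash f.
exists (fun n => val (f (SigSub (in_setT n)))) => [n|m n /val_inj eq_f].
  exact: set_mem (valP _).
have /(congr1 val) // : SigSub (in_setT m) = SigSub (in_setT n).
by apply: inj eq_f; apply: mem_set.
Qed.

Theorem theorem3p4 (R : realType) (M : set R)
    (M_positive : positive_monoid M)
    (M_atomic : atomic M)
    (M_cwo : co_well_ordered M) :
  length_finite_factorization_monoid M.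
Proof.
split=> // b l _ _; have [u [cwo_u eq_M]] := M_cwo.
apply: contrapT => /infinite_set_sequence[z zP z_inj].
have [i lt_il n|f incr_f ni_f] := @simultaneous_nonincreasing_subseq _ u
    (fun i n => (enum_mset (z n))`_i) l cwo_u.
  have [[z_atoms _] size_z] := zP n.
  apply: atoms_sub_generators; rewrite -eq_M; apply: z_atoms.
  by apply: mem_nth; rewrite size_z.
(* any two members of the subsequence would do *)
have [[_ sum0] size0] := zP (f 0%N); have [[_ sum1] size1] := zP (f 1%N).
have eq_z : z (f 1%N) = z (f 0%N).
  (* a multiset is determined by its enumeration, so comparing lists suffices *)
  apply: (can_inj (@seq_mset_id R)); apply: eq_sum_le_eq.
  - by rewrite size0.
  - by move=> i; rewrite size1 => lt_il; apply: (ni_f i lt_il).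
  - by rewrite [LHS]sum1 [RHS]sum0.
by have := incr_f 1%N 0%N; rewrite (z_inj _ _ eq_z) lexx.
Qed.
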